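(* Let $G=(V,E)$ be a countably infinite locally finite graph endowed with the path-length metric. Let $G_1\subset G_2\subset G_3\subset\cdots$ be an ascending sequence of finite convex subgraphs of $G$ such that $G=\bigcup_{n\in\mathbb{N}}G_n$. For each integer $S\ge 0$ and each $n$ let $\varepsilon_{S,G_n}$ be the minimal variation of probability measures on $G_n$ at scale $S$. Then $G$ has property A if and only if $$\lim_{S\to\infty}\ \limsup_{n\to\infty}\ \varepsilon_{S,G_n}=0.$$
   Context: A graph $G=(V,E)$ is oriented, with $E\subset V\times V$ and no self-loops; $ij\in E$ denotes an edge with initial vertex $i$ and terminal vertex $j$. The path-length metric: the distance between two vertices is the number of edges of a shortest undirected path between them (orientation is ignored), and is $\infty$ if there is no such path. $B_G(i,S)$ denotes the closed ball of radius $S$ about $i$ in this metric. For a (possibly infinite) graph $G=(V,E)$ and an integer $S\ge 0$, the minimal variation of probability measures on $G$ at scale $S$, written $\varepsilon_{S,G}$, is the minimal $\varepsilon\ge 0$ for which there is a family of functions $\{\xi_i\colon V\to\mathbb{R}\}_{i\in V}$ with: (1) $\xi_i\ge 0$ and $\|\xi_i\|_1=1$ for each $i\in V$; (2) $\|\xi_i-\xi_j\|_1\le\varepsilon$ for each $ij\in E$; (3) $\{j\in V:\xi_i(j)>0\}\subset B_G(i,S)$ for each $i\in V$. For a subgraph $G_n$, the balls in the definition of $\varepsilon_{S,G_n}$ are taken in the path-length metric of $G_n$. $G$ has property A iff $\lim_{S\to\infty}\varepsilon_{S,G}=0$. $G$ is locally finite if every vertex has finite degree. A subgraph $H$ of $G$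 is convex if for any vertices $i,j$ of $H$ lying in a single connected component of $G$ there is a geodesic of $G$ from $i$ to $j$ contained in $H$. *)

(* Defs.v *)
From mathcomp Require Import all_boot all_order all_algebra.
From mathcomp Require Import all_classical all_reals all_analysis.

Set Implicit Arguments.
Unset Strict Implicit.
Unset Printing Implicit Defensive.

Import Order.TTheory GRing.Theory Num.Theory.
Import numFieldNormedType.Exports.

Local Open Scope classical_set_scope.
Local Open Scope ring_scope.

(* Vertices live in an ambient type T, so that a graph and its subgraphs have
   the same type.  (i, j) \in eset G is the edge ij from i to j. *)
Record graph (T : choiceType) := Graph {
  vset : set T;
  eset : set (T * T);
  eset_vset : forall i j, eset (i, j) -> vset i /\ vset j;
  eset_loopless : forall i, ~ eset (i, i) }.

Section Graph.
Context {T : choiceType}.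
Implicit Types (G H : graph T) (i j : T) (p : seq T) (S : nat).

Definition adj G : rel T :=
  fun i j => ((i, j) \in eset G) || ((j, i) \in eset G).

(* i :: p is the sequence of vertices visited, so the number of edges of the
   path is size p. *)
Definition upath G i p j : Prop := [/\ vset G i, path (adj G) i p & last i p = j].

Definition locally_finite G : Prop :=
  forall i, vset G i -> finite_set [set e | eset G e /\ (e.1 = i \/ e.2 = i)].

Definition subgraph H G : Prop := vset H `<=` vset G /\ eset H `<=` eset G.

End Graph.

Section Metric.
Context (R : realType) {T : choiceType}.
Implicit Types (G H : graph T) (i j : T) (p : seq T) (S : nat).

(* The value is +oo when there is no path, as the infimum of set0. *)
Definition gdist G i j : \bar R :=
  ereal_inf [set (size p)%:R%:E | p in [set p | upath G i p j]].

Definition gball G i S : set T :=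
  [set j | vset G j /\ (gdist G i j <= S%:R%:E)%E].

Definition geodesic G i p j : Prop :=
  upath G i p j /\ (size p)%:R%:E = gdist G i j.

Definition convex_subgraph H G : Prop :=
  subgraph H G /\
  forall i j, vset H i -> vset H j -> (exists p, upath G i p j) ->
    exists p, geodesic G i p j /\ upath H i p j.

End Metric.

Section Variation.
Context {R : realType} {T : choiceType}.
Implicit Types (G : graph T) (S : nat) (xi : T -> T -> R) (f : T -> R).

Definition l1norm G f : \bar R := \esum_(k in vset G) `|f k|%:E.

(* Only the values xi i k with i and k vertices of G matter. *)
Definition prob_family G S (eps : R) xi : Prop :=
  [/\ forall i, vset G i ->
        (forall k, vset G k -> 0 <= xi i k) /\ l1norm G (xi i) = 1%E,
      forall i j, eset G (i, j) ->
        (l1norm G (fun k => xi i k - xi j k)%R <= eps%:E)%E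
    & forall i, vset G i ->
        [set j | vset G j /\ 0 < xi i j] `<=` gball R G i S].

Definition variations S G : set R :=
  [set eps | 0 <= eps /\ exists xi, prob_family G S eps xi].

Lemma esum_delta G i : vset G i ->
  l1norm G (fun k => (k == i)%:R) = 1%E.
Proof.
move=> Gi; rewrite /l1norm (esumID [set i])//.
rewrite setIidr; last by move=> x ->.
rewrite esum_set1// eqxx normr1 esum1 ?adde0// => k [_ /= /eqP/negPf ->].
by rewrite normr0.
Qed.

Lemma variations_has_inf S G : has_inf (variations S G).
Proof.
split; last by exists 0 => e [].
exists 2; split => //; exists (fun i k => (k == i)%:R); split.
- by move=> i Gi; split=> [k _|]; [exact: ler0n|exact: esum_delta].
- move=> i j /eset_vset[Gi Gj].
  apply: (@le_trans _ _ (\esum_(k in vset G)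
      (`|(k == i)%:R : R|%:E + `|(k == j)%:R : R|%:E))%E).
    by apply: le_esum => k _; rewrite -EFinD lee_fin ler_normB.
  rewrite esumD// -!/(l1norm G _) !esum_delta//.
- move=> i Gi k [Gk]; case: eqP => [-> _|_]; last by rewrite ltxx.
  split=> //; apply: (@le_trans _ _ 0%E); last by rewrite lee_fin.
  by apply: ereal_inf_lbound; exists [::].
Qed.

(* The minimal eps, as an infimum; variations_has_inf shows that inf does not
   take its default value. *)
Definition min_variation S G : R := inf (variations S G).

Definition property_A G : Prop :=
  min_variation S G @[S --> \oo] --> (0 : R).

End Variation.

Arguments property_A R {T} G.

(* Main.v *)
Require Import Defs.
From mathcomp Require Import all_boot all_order all_algebra.
From mathcomp Require Import finmap.
From mathcomp Require Import all_classical all_reals all_analysis.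

Set Implicit Arguments.
Unset Strict Implicit.
Unset Printing Implicit Defensive.

Import Order.TTheory GRing.Theory Num.Theory.
Import numFieldNormedType.Exports.

Local Open Scope classical_set_scope.
Local Open Scope ring_scope.

(** The two quantities compared are, up to a change of scale, the same.

    Pushing forward.  If H is a convex subgraph of G, let q send each vertex to
    a nearest vertex of H.  A point k of the ball of radius S about a vertex i
    of H is at distance at most S from q k, because i itself is a candidate for
    q k; so q k is at distance at most 2S from i in G, and in H too since H is
    convex.  The image under q of a family of measures on G of scale S is thus
    a family on H of scale 2S.  Taking images under a map does not increase the
    l1 distance, so the variation of G at scale S bounds that of every G_n at
    scale 2S ([min_variation_convex]), and hence the limsup of the latter.

    Passing to the limit.  If all but finitely many G_n have a family of scale S
    and variation at most eps, the pointwise limit of these families along an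
    ultrafilter exists, because all values lie in [0, 1].  Balls of a locally
    finite graph are finite, and balls of G_n are contained in those of G, so
    the norms of the measure at i and of its difference with the measure at j
    are finite sums over a set that does not depend on n, and the limit
    inherits norm 1 and variation at most eps ([min_variation_limit]).  So the
    variation of G at scale S is at most the limsup of the variations of the
    G_n at the same scale.

    Writing v for the variation of G and L for the limsup, both functions of
    the scale, v S <= L S <= v (S / 2) with S / 2 rounded down: one tends to 0
    iff the other does. *)

(** * Paths and balls *)

Section Paths.
Context {T : choiceType}.
Implicit Types (G H : graph T) (i j k : T) (p : seq T) (d : nat).

Definition linked G d i j : Prop := exists2 p, upath G i p j & (size p <= d)%N.

Lemma adjC G i j : adj G i j = adj G j i.
Proof. by rewrite /adj orbC. Qed.

Lemma adj_vset G i j : adj G i j -> vset G i /\ vset G j.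
Proof. by case/orP; rewrite in_setE => /eset_vset[]. Qed.

Lemma adj_subgraph H G i j : subgraph H G -> adj H i j -> adj G i j.
Proof.
case=> _ sub /orP[] /set_mem /sub/mem_set; rewrite /adj => ->//.
by rewrite orbT.
Qed.

Lemma upath_vset G i p j : upath G i p j -> vset G j.
Proof.
case=> + + <-; elim: p i => //= k p IH i _ /andP[/adj_vset[_ Gk]].
exact: IH.
Qed.

Lemma upath_rev G i p j : upath G i p j -> upath G j (rev (belast i p)) i.
Proof.
move=> Gp; have Gj := upath_vset Gp; case: Gp Gj => Gi Gp <- Gj; split => //.
  by rewrite rev_path; under eq_path do rewrite adjC.
by case: p {Gp Gj} => //= k p; rewrite rev_cons last_rcons.
Qed.

Lemma upath_cat G i j k p q :
  upath G i p j -> upath G j q k -> upath G i (p ++ q) k.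
Proof.
case=> Gi Gp pj [_ Gq qk]; split => //.
  by rewrite cat_path Gp pj.
by rewrite last_cat pj.
Qed.

Lemma upath_subgraph H G i p j : subgraph H G -> upath H i p j -> upath G i p j.
Proof.
move=> HG [Hi Hp pj]; split => //; first exact: HG.1.
by apply: sub_path Hp => x y; exact: adj_subgraph.
Qed.

Lemma linked_sym G d i j : linked G d i j -> linked G d j i.
Proof.
case=> p Gp pd; exists (rev (belast i p)); first exact: upath_rev.
by rewrite size_rev size_belast.
Qed.

Lemma linked_trans G d e i j k :
  linked G d i j -> linked G e j k -> linked G (d + e) i k.
Proof.
move=> [p Gp pd] [q Gq qe]; exists (p ++ q); first exact: upath_cat Gp Gq.
by rewrite size_cat leq_add.
Qed.

Lemma linked_leq G d e i j : (d <= e)%N -> linked G d i j -> linked G e i j.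
Proof. by move=> de [p Gp pd]; exists p => //; exact: leq_trans de. Qed.

Lemma linked_subgraph H G d i j :
  subgraph H G -> linked H d i j -> linked G d i j.
Proof. by move=> HG [p Hp pd]; exists p => //; exact: upath_subgraph Hp. Qed.

(** Induction on the radius: a nontrivial path starts with one of the finitely
    many edges at i. *)
Lemma finite_linked G d i : locally_finite G -> finite_set (linked G d i).
Proof.
move=> lf; elim: d i => [|d IH] i.
  apply: (sub_finite_set _ (finite_set1 i)) => j [[|//] [_ _ <-]] //.
have [Gi|nGi] := pselect (vset G i); last first.
  by apply: (sub_finite_set _ (@finite_set0 T)) => j [p []].
pose N := fst @` [set e | eset G e /\ (e.1 = i \/ e.2 = i)] `|`
          snd @` [set e | eset G e /\ (e.1 = i \/ e.2 = i)].
have Nfin : finite_set N.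
  by rewrite finite_setU; split; apply: finite_image; exact: lf.
apply: (@sub_finite_set _ _ ([set i] `|` \bigcup_(k in N) linked G d k)).
  move=> j [[|k p] [_ /= + <-]]; first by left.
  move=> /andP[ik kp] pd; right; exists k.
    case/orP: ik => /set_mem ik; [right|left].
      by exists (i, k) => //; split => //; left.
    by exists (k, i) => //; split => //; right.
  by exists p => //; split => //; case: (adj_vset ik).
by rewrite finite_setU; split=> //; apply: bigcup_finite => // k _; exact: IH.
Qed.

End Paths.

Section Balls.
Context {R : realType} {T : choiceType}.
Implicit Types (G H : graph T) (i j k : T) (S : nat).

(** Distances are infima in the extended reals; lengths are integers, so an
    infimum at most S, hence less than S + 1, is witnessed by a path of length
    at most S. *)
Lemma gballP G i S j : gball R G i S j <-> linked G S i j.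
Proof.
split=> [[_ dS]|[p Gp pS]].
  have : (gdist R G i j < S.+1%:R%:E)%E.
    by rewrite (le_lt_trans dS)// lte_fin ltr_nat.
  case/ereal_inf_lt => _ [p Gp <-]; rewrite lte_fin ltr_nat ltnS => pS.
  by exists p.
split; first exact: upath_vset Gp.
apply: (@le_trans _ _ (size p)%:R%:E); last by rewrite lee_fin ler_nat.
by apply: ereal_inf_lbound; exists p.
Qed.

Lemma convex_linked H G d i j : convex_subgraph R H G ->
  vset H i -> vset H j -> linked G d i j -> linked H d i j.
Proof.
move=> [HG cvx] Hi Hj wij; have [p [[Gp dE] Hp]] : exists p,
    geodesic R G i p j /\ upath H i p j.
  by apply: cvx => //; case: wij => p Gp _; exists p.
exists p => //; case/gballP: wij => _.
by rewrite -dE lee_fin ler_nat.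
Qed.

(** A nearest vertex of H to k is within d of k as soon as some vertex of H is.
    On a component of G that H does not meet, q is arbitrary. *)
Lemma nearest_point H G : exists q : T -> T, forall i k d, vset H i ->
  linked G d i k -> vset H (q k) /\ linked G d (q k) k.
Proof.
suff /choice[q qP] : forall k, exists m, forall i d, vset H i ->
    linked G d i k -> vset H m /\ linked G d m k.
  by exists q => i k d; exact: qP.
move=> k.
have [exd|none] :=
  pselect (exists d, `[< exists2 i, vset H i & linked G d i k >]); last first.
  exists k => i d Hi w; exfalso; apply: none; exists d.
  by apply/asboolP; exists i.
have [d /asboolP[m Hm wm] dmin] := ex_minnP exd.
exists m => i e Hi w; split => //; apply: linked_leq wm; apply: dmin.
by apply/asboolP; exists i.
Qed.

End Balls.

(** * Families of finitely supported measures *)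

Section Families.
Context {R : realType} {T : choiceType}.
Implicit Types (G H : graph T) (i j k : T) (S : nat) (f : T -> R) (F : set T).
Implicit Types (xi : T -> T -> R).

Lemma l1norm_finite G f F : finite_set F ->
  (forall k, f k != 0 -> vset G k /\ F k) ->
  l1norm G f = (\sum_(k <- fset_set F) `|f k|)%:E.
Proof.
move=> Ffin fsupp; rewrite -sumEFin -fsbig_finite// -esum_fset//.
rewrite /l1norm esum_mkcond [RHS]esum_mkcond; apply: eq_esum => k _.
have [/fsupp[Gk Fk]|/negPn/eqP->] := boolP (f k != 0).
  by rewrite !mem_set.
by rewrite normr0; do 2 case: ifP.
Qed.

Lemma eq_l1norm G f g : (forall k, vset G k -> f k = g k) ->
  l1norm G f = l1norm G g.
Proof. by move=> fg; apply: eq_esum => k Gk; rewrite fg. Qed.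

(** The values at pairs of vertices of G alone are constrained in a
    [prob_family]; here the bounds hold on all of T, so that the functions for
    several graphs can be summed over a common finite set. *)
Definition ball_family G S xi := forall i k,
  0 <= xi i k <= 1 /\ (xi i k != 0 -> vset G k /\ linked G S i k).

Lemma prob_family_truncate G S eps xi : prob_family G S eps xi ->
  exists xi', prob_family G S eps xi' /\ ball_family G S xi'.
Proof.
move=> [xi1 xi2 xi3].
pose xi' i k := if `[< vset G i /\ vset G k >] then xi i k else 0.
have xi'E i k : vset G i -> vset G k -> xi' i k = xi i k.
  by move=> Gi Gk; rewrite /xi'; case: asboolP => // -[].
exists xi'; split; last first.
  move=> i k; rewrite /xi'; case: asboolP => [[Gi Gk]|]; last first.
    by rewrite eqxx lexx ler01.
  have [ge0 n1] := xi1 _ Gi; have ge0k := ge0 _ Gk; split.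
    rewrite ge0k -lee_fin -n1 /=; apply: esum_ge; exists [set k].
      by split => // _ ->.
    by rewrite fsbig_set1 ger0_norm.
  move=> ne0; split => //; apply/(gballP (R := R)); apply: (xi3 _ Gi).
  by split => //; rewrite lt_neqAle eq_sym ne0.
split.
- move=> i Gi; have [ge0 n1] := xi1 _ Gi; split.
    by move=> k Gk; rewrite xi'E//; exact: ge0.
  by rewrite -n1; apply: eq_l1norm => k Gk; rewrite xi'E.
- move=> i j ij; have [Gi Gj] := eset_vset ij; apply: le_trans (xi2 _ _ ij).
  by rewrite le_eqVlt; apply/orP; left; apply/eqP/eq_l1norm => k Gk;
     rewrite !xi'E.
- by move=> i Gi k [Gk]; rewrite xi'E// => ?; apply: (xi3 _ Gi).
Qed.

Lemma min_variation_ge0 S G : 0 <= min_variation S G :> R.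
Proof.
by apply: lb_le_inf; [case: (variations_has_inf (R := R) S G)|move=> e []].
Qed.

Lemma min_variation_le S G eps xi : 0 <= eps -> prob_family G S eps xi ->
  min_variation S G <= eps.
Proof.
move=> e0 xiP; apply: ge_inf; first exact: (variations_has_inf S G).2.
by split=> //; exists xi.
Qed.

Lemma min_variation_lt S G eps : min_variation S G < eps ->
  exists xi, prob_family G S eps xi /\ ball_family G S xi.
Proof.
case/inf_lt; first exact: (variations_has_inf S G).1.
move=> e [_ [xi [xi1 xi2 xi3]]] /ltW le_e; apply: prob_family_truncate.
split; [exact: xi1|move=> i j /xi2/le_trans|exact: xi3].
by apply; rewrite lee_fin.
Qed.

End Families.

(** * Retraction onto a convex subgraph *)

Section Pushforward.
Context {R : realType} {T : choiceType}.
Implicit Types (G H : graph T) (i j k m : T) (S : nat) (f g : T -> R).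
Implicit Types (F : set T) (q : T -> T).

(** The sum ranges over the support of f in the fibre, so that additivity in f
    needs no common finite set to be chosen in advance. *)
Definition pushforward q f m : R := \sum_(k \in q @^-1` [set m]) f k.

Lemma pushforwardE q f F m : finite_set F -> (forall k, f k != 0 -> F k) ->
  pushforward q f m = \sum_(k <- fset_set F | q k == m) f k.
Proof.
move=> Ffin fF; rewrite /pushforward.
rewrite (@fsbigE _ _ _ _ _ [seq k <- fset_set F | q k == m]).
- rewrite big_filter_cond; apply: eq_bigl => k.
  by apply/andP/idP => [[]//|/eqP qk]; split; [apply/eqP|apply/mem_set].
- exact: filter_uniq.
- by move=> k /=; rewrite mem_filter => /andP[/eqP].
- move=> k /= qk; rewrite mem_filter qk eqxx /= in_fset_set// => nFk.
  by apply/eqP/negP => /negP/fF/mem_set; rewrite (negPf nFk).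
Qed.

Lemma pushforwardB q f g F m : finite_set F ->
  (forall k, f k != 0 -> F k) -> (forall k, g k != 0 -> F k) ->
  pushforward q (fun k => f k - g k) m = pushforward q f m - pushforward q g m.
Proof.
move=> Ffin fF gF; rewrite !(@pushforwardE _ _ F)//; first exact: sumrB.
move=> k; have [|/negPn/eqP->] := boolP (f k != 0); first by move/fF.
by rewrite sub0r oppr_eq0; exact: gF.
Qed.

Lemma pushforward_neq0 q f F m : finite_set F -> (forall k, f k != 0 -> F k) ->
  pushforward q f m != 0 -> exists2 k, f k != 0 & q k = m.
Proof.
move=> Ffin fF; rewrite (pushforwardE _ _ Ffin fF) => ne0.
apply: contrapT => no; move: ne0; rewrite big1 ?eqxx// => k /eqP qk.
by apply/eqP/negP => /negP fk; apply: no; exists k.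
Qed.

Lemma pushforward_ge0 q f F m : finite_set F -> (forall k, f k != 0 -> F k) ->
  (forall k, 0 <= f k) -> 0 <= pushforward q f m.
Proof. by move=> Ffin fF f0; rewrite (pushforwardE _ _ Ffin fF) sumr_ge0. Qed.

Lemma sum_fibers q f F : finite_set F ->
  \sum_(m <- fset_set (q @` F)) \sum_(k <- fset_set F | q k == m) f k =
  \sum_(k <- fset_set F) f k.
Proof.
move=> Ffin; under eq_bigr do rewrite big_mkcond.
rewrite exchange_big /= big_seq [RHS]big_seq; apply: eq_bigr => k.
rewrite in_fset_set// => /set_mem Fk.
rewrite (bigD1_seq (q k)) ?eqxx//=; last first.
  by rewrite in_fset_set; [apply/mem_set; exists k|exact: finite_image].
by rewrite big1 ?addr0// => m; rewrite eq_sym => /negPf->.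
Qed.

(** The triangle inequality in each fibre of q; for nonnegative f there is no
    cancellation and the total mass is preserved. *)
Lemma l1norm_pushforward G H q f F : finite_set F ->
  (forall k, f k != 0 -> [/\ vset G k, F k & vset H (q k)]) ->
  (l1norm H (pushforward q f) <= l1norm G f)%E /\
  ((forall k, 0 <= f k) -> l1norm H (pushforward q f) = l1norm G f).
Proof.
move=> Ffin fsupp.
have fF k : f k != 0 -> F k by case/fsupp.
rewrite (@l1norm_finite _ _ G f F)//; last by move=> k /fsupp[].
rewrite (@l1norm_finite _ _ H _ (q @` F)); last 2 first.
- exact: finite_image.
- move=> m /(pushforward_neq0 Ffin fF)[k /fsupp[_ Fk Hqk] <-].
  by split=> //; exists k.
split=> [|f0].
  rewrite lee_fin -(sum_fibers q _ Ffin); apply: ler_sum => m _.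
  by rewrite (pushforwardE _ _ Ffin fF); exact: ler_norm_sum.
congr _%:E; rewrite -(sum_fibers q _ Ffin); apply: eq_bigr => m _.
rewrite ger0_norm ?(pushforward_ge0 _ _ Ffin)// (pushforwardE _ _ Ffin fF).
by apply: eq_bigr => k _; rewrite ger0_norm.
Qed.

(** The image of the measures under a nearest-point retraction: the ball about
    i of radius S is moved by at most S, since i belongs to H. *)
Lemma min_variation_convex G H S S' : locally_finite G ->
  convex_subgraph R H G -> (2 * S <= S')%N ->
  min_variation S' H <= min_variation S G :> R.
Proof.
move=> lf cvx le2S; have [HG _] := cvx; have [q qP] := nearest_point H G.
apply: lb_le_inf; first exact: (variations_has_inf S G).1.
move=> e [e0 [xi0 /prob_family_truncate[xi [[xi1 xi2 _] xiB]]]].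
have xi_supp i k : xi i k != 0 -> linked G S i k by case/(xiB _ _).2.
have bfin i : finite_set (linked G S i) by exact: finite_linked.
pose eta i := pushforward q (xi i).
apply: (min_variation_le e0 (xi := eta)); split.
- move=> i Hi; split.
    move=> k _; apply: (pushforward_ge0 q k (bfin i) (xi_supp i)) => k'.
    by case/andP: (xiB i k').1.
  have [_ <-] := xi1 _ (HG.1 _ Hi).
  apply: (l1norm_pushforward (F := linked G S i) _ _).2 => //.
    move=> k xik; have [Gk w] := (xiB _ _).2 xik.
    by split=> //; case: (qP _ _ _ Hi w).
  by move=> k; case/andP: (xiB i k).1.
- move=> i j ij; have [Hi Hj] := eset_vset ij.
  apply: le_trans (xi2 _ _ (HG.2 _ ij)).
  pose F := linked G S i `|` linked G S j.
  have Ffin : finite_set F by rewrite finite_setU.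
  have Fi k : xi i k != 0 -> F k by move/xi_supp; left.
  have Fj k : xi j k != 0 -> F k by move/xi_supp; right.
  rewrite (@eq_l1norm _ _ _ _ (pushforward q (fun k => xi i k - xi j k))).
    apply: (l1norm_pushforward (F := F) Ffin _).1 => k.
    have [xik _|/negPn/eqP->] := boolP (xi i k != 0).
      have [Gk w] := (xiB _ _).2 xik.
      by split=> //; [left|case: (qP _ _ _ Hi w)].
    rewrite sub0r oppr_eq0 => /(xiB _ _).2[Gk w].
    by split=> //; [right|case: (qP _ _ _ Hj w)].
  by move=> k _; rewrite (pushforwardB _ _ Ffin).
- move=> i Hi m [Hm] /lt0r_neq0/(pushforward_neq0 (bfin i) (xi_supp i)).
  move=> [k /xi_supp w qk]; apply/gballP; apply: (convex_linked cvx) => //.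
  have [_] := qP _ _ _ Hi w; rewrite qk => /linked_sym wm.
  by apply: linked_leq le2S _; rewrite mul2n -addnn; exact: linked_trans w wm.
Qed.

End Pushforward.

(** * Limits along an ultrafilter *)

Section Limits.
Context {R : realType} {T : choiceType}.

Lemma ultra_fmap (X Y : Type) (h : X -> Y) (U : set_system X) :
  UltraFilter U -> UltraFilter (h @ U).
Proof.
move=> UU; have UP : ProperFilter U := ultra_proper.
split; first exact: fmap_proper_filter.
move=> G GP sub; apply/seteqP; split=> // A GA.
have [//|UnA] := in_ultra_setVsetC (h @^-1` A) UU.
by exfalso; apply: (filter_not_empty G); rewrite -(setICr A);
   apply: filterI => //; exact: sub.
Qed.

Lemma ultra_bounded_cvg (X : Type) (U : set_system X) (h : X -> R) (a b : R) :
  UltraFilter U -> (\forall x \near U, a <= h x <= b) ->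
  exists l : R, h x @[x --> U] --> l.
Proof.
move=> UU hab; have := @segment_compact R a b; rewrite compact_ultra.
move=> /(_ (h @ U) (ultra_fmap h UU))[|l [_ hl]]; last by exists l.
by apply: filterS hab => x; rewrite /= in_itv.
Qed.

Lemma cvg_sum_norm (X I : Type) (F : set_system X) (s : seq I)
    (h : X -> I -> R) (l : I -> R) : Filter F ->
  (forall k, h x k @[x --> F] --> l k) ->
  \sum_(k <- s) `|h x k| @[x --> F] --> \sum_(k <- s) `|l k|.
Proof.
move=> FF hl; apply: cvg_big => [|k _]; first exact: add_continuous.
by apply: cvg_norm; exact: hl.
Qed.

Lemma ascending_subgraph (Gn : nat -> graph T) :
  (forall n, subgraph (Gn n) (Gn n.+1)) ->
  forall n m, (n <= m)%N -> subgraph (Gn n) (Gn m).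
Proof.
move=> asc n m; elim: m => [|m IH]; first by rewrite leqn0 => /eqP->; split.
rewrite leq_eqVlt => /orP[/eqP->|]; first by split.
rewrite ltnS => /IH[V E]; have [V' E'] := asc m.
by split=> x ?; [apply: V'; exact: V|apply: E'; exact: E].
Qed.

(** Pointwise limit of almost optimal families on the G_n.  Local finiteness
    keeps mass from escaping: all supports lie in a fixed finite ball of G. *)
Lemma min_variation_limit (G : graph T) (Gn : nat -> graph T) (S : nat)
    (eps : R) (U : set_system nat) :
  locally_finite G -> UltraFilter U ->
  (forall n, subgraph (Gn n) G) ->
  (forall i, vset G i -> \forall n \near U, vset (Gn n) i) ->
  (forall e, eset G e -> \forall n \near U, eset (Gn n) e) ->
  (\forall n \near U, min_variation S (Gn n) < eps) ->
  min_variation S G <= eps.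
Proof.
move=> lf UU sub Gnv Gne varlt; have UP : ProperFilter U := ultra_proper.
have /choice[xin xinP] : forall n, exists xi : T -> T -> R,
    min_variation S (Gn n) < eps ->
    prob_family (Gn n) S eps xi /\ ball_family (Gn n) S xi.
  move=> n; have [lt|nlt] := pselect (min_variation S (Gn n) < eps).
    by have [xi xiP] := min_variation_lt lt; exists xi.
  by exists (fun _ _ => 0) => /nlt.
have e0 : 0 <= eps.
  by have [n /ltW] := filter_ex varlt; apply: le_trans;
    exact: min_variation_ge0.
have cvg_xin i k : exists l : R, xin n i k @[n --> U] --> l.
  apply: (ultra_bounded_cvg (a := 0) (b := 1)).
  by apply: filterS varlt => n /xinP[_ /(_ i k)[]].
have /choice[xi xi_cvg] : forall i, exists f : T -> R, forall k,
    xin n i k @[n --> U] --> f k.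
  by move=> i; have [f fP] := choice (cvg_xin i); exists f.
have xin_supp n i k : min_variation S (Gn n) < eps -> xin n i k != 0 ->
    linked G S i k.
  by move=> /xinP[_ /(_ i k)[_ supp]] /supp[_]; exact: linked_subgraph.
have xi_supp i k : xi i k != 0 -> linked G S i k.
  move=> xi0; apply: contrapT => nik; move/eqP: xi0; apply.
  apply: (cvg_unique _ (xi_cvg i k)) => //; apply: cvg_near_cst.
  apply: filterS varlt => n lt; apply/eqP/negP => /negP.
  by move/(xin_supp _ _ _ lt).
have linked_vset i k : linked G S i k -> vset G k by case=> p /upath_vset.
have bfin i : finite_set (linked G S i) by exact: finite_linked.
have xi_ge0 i k : 0 <= xi i k.
  apply: (cvgr_to_ge (xi_cvg i k)); apply: filterS varlt => n /xinP[_].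
  by move=> /(_ i k)[/andP[]].
apply: (min_variation_le e0 (xi := xi)); split.
- move=> i Gi; split=> [k _|]; first exact: xi_ge0.
  rewrite (@l1norm_finite _ _ _ _ _ (bfin i)); last first.
    by move=> k /xi_supp w; split=> //; exact: linked_vset w.
  congr _%:E.
  have lim : \sum_(k <- fset_set (linked G S i)) `|xin n i k| @[n --> U] -->
      \sum_(k <- fset_set (linked G S i)) `|xi i k|.
    by apply: cvg_sum_norm.
  apply: (cvg_unique _ lim) => //; apply: cvg_near_cst.
  apply: filterS2 (Gnv _ Gi) varlt => n Gni lt.
  have [[/(_ _ Gni)[_ +] _ _] xiB] := xinP _ lt.
  rewrite (@l1norm_finite _ _ _ _ _ (bfin i)); first by case.
  by move=> k xik; split; [case: (xiB i k).2|exact: xin_supp xik].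
- move=> i j ij; pose F := linked G S i `|` linked G S j.
  have Ffin : finite_set F by rewrite finite_setU.
  rewrite (@l1norm_finite _ _ _ _ _ Ffin); last first.
    move=> k; have [/xi_supp w _|/negPn/eqP->] := boolP (xi i k != 0).
      by split; [exact: linked_vset w|left].
    rewrite sub0r oppr_eq0 => /xi_supp w.
    by split; [exact: linked_vset w|right].
  rewrite lee_fin.
  have lim : \sum_(k <- fset_set F) `|xin n i k - xin n j k| @[n --> U] -->
      \sum_(k <- fset_set F) `|xi i k - xi j k|.
    by apply: cvg_sum_norm => k; apply: cvgB.
  apply: (cvgr_to_le lim).
  apply: filterS2 (Gne _ ij) varlt => n Gnij lt.
  have [[_ /(_ _ _ Gnij) + _] xiB] := xinP _ lt.
  rewrite (@l1norm_finite _ _ _ _ _ Ffin) ?lee_fin// => k.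
  have [xik _|/negPn/eqP->] := boolP (xin n i k != 0).
    by split; [case: (xiB i k).2|left; exact: xin_supp xik].
  rewrite sub0r oppr_eq0 => xjk.
  by split; [case: (xiB j k).2|right; exact: xin_supp xjk].
- by move=> i Gi k [_ /lt0r_neq0/xi_supp w]; apply/gballP.
Qed.

End Limits.

(** * The limsup of the variations *)

Section Limsup.
Context {R : realType}.
Implicit Types (u : nat -> \bar R) (x : \bar R).

Lemma limn_esup_near_lt u x : (limn_esup u < x)%E ->
  \forall n \near \oo, (u n < x)%E.
Proof.
case/ereal_inf_lt => _ [A Aoo <-] Ax; apply: filterS Aoo => n An.
by apply: le_lt_trans Ax; apply: ereal_sup_ubound; exists n.
Qed.

Lemma limn_esup_le u x : (forall n, (u n <= x)%E) -> (limn_esup u <= x)%E.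
Proof.
move=> ux; apply: (@le_trans _ _ (ereal_sup [set u n | n in setT])).
  by apply: ereal_inf_lbound; exists setT => //; exact: filterT.
by apply: ge_ereal_sup => _ [n _ <-].
Qed.

Lemma limn_esup_ge0 u : (forall n, (0 <= u n)%E) -> (0 <= limn_esup u)%E.
Proof. by move=> u0; apply: limf_esup_ge0. Qed.

End Limsup.

Theorem theorem2p4 (R : realType) (T : choiceType) (G : graph T)
  (Gcount : countable (vset G)) (Ginf : infinite_set (vset G))
  (Glf : locally_finite G)
  (Gn : nat -> graph T)
  (Gn_fin : forall n, finite_set (vset (Gn n)))
  (Gn_conv : forall n, convex_subgraph R (Gn n) G)
  (Gn_asc : forall n, subgraph (Gn n) (Gn n.+1))
  (Gn_vset : \bigcup_n vset (Gn n) = vset G)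
  (Gn_eset : \bigcup_n eset (Gn n) = eset G) :
  property_A R G <->
  limn_esup (fun n => (min_variation S (Gn n) : R)%:E) @[S --> \oo] --> 0%E.
Proof.
set L := fun S : nat => limn_esup (fun n => (min_variation S (Gn n) : R)%:E).
have L_ge0 S : (0 <= L S)%E.
  by apply: limn_esup_ge0 => n; rewrite lee_fin min_variation_ge0.
have L_le S S' : (2 * S <= S')%N -> (L S' <= (min_variation S G : R)%:E)%E.
  move=> le2S; apply: limn_esup_le => n; rewrite lee_fin.
  exact: min_variation_convex.
have Gn_sub n : subgraph (Gn n) G by case: (Gn_conv n).
have asc := ascending_subgraph Gn_asc.
have [U [UU Uoo]] := @ultraFilterLemma _ \oo _.
have L_ge S : ((min_variation S G : R)%:E <= L S)%E.
  have le_real e : (L S < e%:E)%E -> min_variation S G <= e.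
    move=> /limn_esup_near_lt lt; apply: (min_variation_limit Glf UU Gn_sub).
    - move=> i; rewrite -Gn_vset => -[n _ Gni]; apply: Uoo.
      exists n => // m nm.
      by apply: (asc n m nm).1.
    - move=> ij; rewrite -Gn_eset => -[n _ Gnij]; apply: Uoo.
      exists n => // m nm.
      by apply: (asc n m nm).2.
    - by apply: Uoo; apply: filterS lt => n; rewrite lte_fin.
  (* L S is an extended real; the bound is trivial if it is infinite. *)
  case: (L S) (L_ge0 S) le_real => [l _ le_l|_ _|//]; last by rewrite leey.
  rewrite lee_fin; apply/ler_addgt0Pr => e e0; apply: le_l.
  by rewrite lte_fin ltrDl.
split=> [pA|L0].
  apply: (@squeeze_cvge _ _ _ _ (cst 0%E) _
    (fun S => (min_variation S./2 G : R)%:E)).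
  - apply: nearW => S; rewrite L_ge0 /=; apply: L_le.
    by rewrite mul2n -geq_half_double.
  - exact: cvg_cst.
  - apply: cvg_EFin; first exact: nearW.
    have half_oo : S./2 @[S --> \oo] --> \oo.
      apply/cvgnyPge => A; exists A.*2 => // S /=.
      by rewrite geq_half_double.
    exact: cvg_comp half_oo pA.
apply: (@fine_cvg _ _ _ _ (fun S => (min_variation S G)%:E)).
apply: (squeeze_cvge _ (cvg_cst 0%E) L0); apply: nearW => S.
by rewrite L_ge lee_fin min_variation_ge0.
Qed.
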